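(* Let $M$ be an oriented matroid on a (finite) linearly ordered set $E$. Then $$t(M;x,y)=\sum_{\substack{A\subseteq E\\ \overline{\theta}^*_M(A)=0,\ \overline{\theta}_M(A)=0}}x^{\theta^*_M(A)}\,y^{\theta_M(A)},$$ where $t(M;x,y)$ denotes the Tutte polynomial of (the underlying matroid of) $M$.
   Context: The Tutte polynomial of a matroid $M$ on $E$ is $t(M;x,y)=\sum_{A\subseteq E}(x-1)^{r(M)-r_M(A)}(y-1)^{|A|-r_M(A)}$, where $r_M(A)$ is the rank of $A$ in $M$ and $r(M)=r_M(E)$; for an oriented matroid one uses the underlying matroid. Let $M$ be an oriented matroid on a finite linearly ordered set $E$. A positive circuit (resp. cocircuit) is a signed circuit (resp. cocircuit) $X=(X^+,X^-)$ with $X^-=\emptyset$. $O(M)$ is the set of elements of $E$ that are the smallest element of some positive circuit of $M$, and $O^*(M)=O(M^* )$ is the set of elements of $E$ that are the smallest element of some positive cocircuit of $M$. For $A\subseteq E$, $-_AM$ denotes the oriented matroid obtained from $M$ by reorientation on $A$ (the signs of the elements of $A$ are reversed in all signed circuits and cocircuits). The four $\theta$-activities of $A\subseteq E$ are $$\theta_M(A)=|O(-_AM)\setminus A|,\quad \overline{\theta}_M(A)=|O(-_AM)\cap A|,$$ $$\theta^*_M(A)=|O^*(-_AM)\setminus A|,\quad \overline{\theta}^*_M(A)=|O^*(-_AM)\cap A|.$$ *)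

(* Defs.v *)
From mathcomp Require Import all_boot all_order all_algebra.
From mathcomp Require Import mpoly.

Set Implicit Arguments.
Unset Strict Implicit.
Unset Printing Implicit Defensive.

Import Order.TTheory GRing.Theory.

Record matroid (E : finType) := Matroid {
  mcircuits : {set {set E}};
  mcircuit_neq0 : set0 \notin mcircuits;
  mcircuit_incomp :
    {in mcircuits &, forall C D : {set E}, C \subset D -> C = D};
  mcircuit_elim :
    {in mcircuits &, forall (C D : {set E}) (e : E),
      C <> D -> e \in C :&: D ->
      exists2 F, F \in mcircuits & F \subset (C :|: D) :\ e}
}.

Section Matroid.

Variables (E : finType) (N : matroid E).
Implicit Types A B D : {set E}.

Definition indep A := [forall C in mcircuits N, ~~ (C \subset A)].

Definition basis B := maxset indep B.

Definition rank A : nat := \max_(B : {set E} | indep B && (B \subset A)) #|B|.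

(* The independent sets of the dual matroid are the subsets of complements of
   bases, so its circuits are the minimal sets meeting every basis. *)
Definition mcocircuit D :=
  minset (fun F : {set E} => [forall B, basis B ==> (F :&: B != set0)]) D.

Local Open Scope ring_scope.

(* In [{mpoly int[2]}], the variable x is ['X_0] and y is ['X_1]; the exponents
   are natural number subtractions, with [rank A <= rank [set: E]] and
   [rank A <= #|A|]. *)
Definition tutte : {mpoly int[2]} :=
  \sum_(A : {set E}) ('X_0 - 1) ^+ (rank [set: E] - rank A)
                     * ('X_1 - 1) ^+ (#|A| - rank A).

End Matroid.

(* A signed set X = (X^+, X^-) is a pair of sets; disjointness of the two parts
   is imposed on circuits and cocircuits. *)
Definition signed (E : finType) : Type := ({set E} * {set E})%type.

Section Signed.

Variable E : finType.
Implicit Types (X Y : signed E) (A : {set E}).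

Definition supp X : {set E} := X.1 :|: X.2.

Definition sopp X : signed E := (X.2, X.1).

Definition sreorient A X : signed E :=
  ((X.1 :\: A) :|: (X.2 :&: A), (X.2 :\: A) :|: (X.1 :&: A)).

Definition orthogonal X Y :=
  ((X.1 :&: Y.1) :|: (X.2 :&: Y.2) == set0)
    == ((X.1 :&: Y.2) :|: (X.2 :&: Y.1) == set0).

Lemma supp_sopp X : supp (sopp X) = supp X.
Proof. by rewrite /supp setUC. Qed.

Lemma soppK : involutive sopp.
Proof. by case. Qed.

Lemma sreorientK A : involutive (sreorient A).
Proof.
case=> P N; congr pair; apply/setP=> e; rewrite !inE /=;
  by case: (e \in A); case: (e \in P); case: (e \in N).
Qed.

Lemma supp_sreorient A X : supp (sreorient A X) = supp X.
Proof.
apply/setP=> e; rewrite !inE /=.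
by case: (e \in A); case: (e \in X.1); case: (e \in X.2).
Qed.

Lemma sreorient_sopp A X : sreorient A (sopp X) = sopp (sreorient A X).
Proof. by []. Qed.

Lemma sreorient_disjoint A X :
  [disjoint X.1 & X.2] ->
  [disjoint (sreorient A X).1 & (sreorient A X).2].
Proof.
rewrite -!setI_eq0 => /eqP dX; apply/eqP/setP=> e.
move/setP/(_ e): dX; rewrite !inE /=.
by case: (e \in A); case: (e \in X.1); case: (e \in X.2).
Qed.

Lemma orthogonal_sreorient A X Y :
  orthogonal (sreorient A X) (sreorient A Y) = orthogonal X Y.
Proof.
rewrite /orthogonal; congr eq_op; congr eq_op;
  apply/setP=> e; rewrite !inE /=;
  by case: (e \in A); case: (e \in X.1); case: (e \in X.2);
     case: (e \in Y.1); case: (e \in Y.2).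
Qed.

End Signed.

Record orientedMatroid (E : finType) := OrientedMatroid {
  circuits : {set signed E};
  circuit_disjoint : {in circuits, forall X : signed E, [disjoint X.1 & X.2]};
  circuit_neq0 : (set0, set0) \notin circuits;
  circuit_opp : {in circuits, forall X : signed E, sopp X \in circuits};
  circuit_incomp :
    {in circuits &, forall X Y : signed E,
      supp X \subset supp Y -> X = Y \/ X = sopp Y};
  circuit_elim :
    {in circuits &, forall (X Y : signed E) (e : E),
      X <> sopp Y -> e \in X.1 :&: Y.2 ->
      exists2 Z, Z \in circuits &
        (Z.1 \subset (X.1 :|: Y.1) :\ e) && (Z.2 \subset (X.2 :|: Y.2) :\ e)}
}.

Section OrientedMatroid.

Variables (E : finType) (M : orientedMatroid E).
Implicit Types (X Y Z : signed E) (A : {set E}).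

Let ucircuits : {set {set E}} := [set supp X | X in circuits M].

Fact underlying_neq0 : set0 \notin ucircuits.
Proof.
apply/imsetP=> -[[P N] XC /esym/eqP]; rewrite setU_eq0 /= => /andP[/eqP P0].
by move/eqP=> N0; move: XC (circuit_neq0 M); rewrite P0 N0 => ->.
Qed.

Fact underlying_incomp :
  {in ucircuits &, forall C D : {set E}, C \subset D -> C = D}.
Proof.
move=> _ _ /imsetP[X XC ->] /imsetP[Y YC ->] /(circuit_incomp XC YC)[] -> //.
exact: supp_sopp.
Qed.

Fact underlying_elim :
  {in ucircuits &, forall (C D : {set E}) (e : E),
    C <> D -> e \in C :&: D ->
    exists2 F, F \in ucircuits & F \subset (C :|: D) :\ e}.
Proof.
move=> _ _ /imsetP[X XC ->] /imsetP[Y YC ->] e neqXY /setIP[eX eY].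
have [X' [X'C sX eX']] :
    exists X', [/\ X' \in circuits M, supp X' = supp X & e \in X'.1].
  case/setUP: eX => eX; first by exists X.
  by exists (sopp X); rewrite circuit_opp // supp_sopp.
have [Y' [Y'C sY eY']] :
    exists Y', [/\ Y' \in circuits M, supp Y' = supp Y & e \in Y'.2].
  case/setUP: eY => eY; last by exists Y.
  by exists (sopp Y); rewrite circuit_opp // supp_sopp.
have neq : X' <> sopp Y'.
  by move=> eq; apply: neqXY; rewrite -sX -sY eq supp_sopp.
have eXY : e \in X'.1 :&: Y'.2 by rewrite inE eX'.
have [Z ZC /andP[Z1 Z2]] := circuit_elim X'C Y'C neq eXY.
exists (supp Z); first exact: imset_f.
rewrite -sX -sY subUset; apply/andP; split.
  by apply: subset_trans Z1 _; rewrite setSD // setUSS // subsetUl.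
by apply: subset_trans Z2 _; rewrite setSD // setUSS // subsetUr.
Qed.

Definition underlying : matroid E :=
  Matroid underlying_neq0 underlying_incomp underlying_elim.

(* The signed circuits of the dual oriented matroid: the signature of the
   cocircuits of the underlying matroid that is orthogonal to all signed
   circuits. *)
Definition cocircuits : {set signed E} :=
  [set Y : signed E | [&& [disjoint Y.1 & Y.2],
                          mcocircuit underlying (supp Y) &
                          [forall X in circuits M, orthogonal X Y]]].

Variable A : {set E}.

Let rcircuits : {set signed E} := sreorient A @: circuits M.

Let rcircuitsE X : (X \in rcircuits) = (sreorient A X \in circuits M).
Proof.
by rewrite -{1}[X](sreorientK A) mem_imset //; apply: can_inj (sreorientK A).
Qed.

Fact reorient_disjoint :
  {in rcircuits, forall X : signed E, [disjoint X.1 & X.2]}.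
Proof.
by move=> _ /imsetP[X XC ->]; apply/sreorient_disjoint/(circuit_disjoint XC).
Qed.

Fact reorient_neq0 : (set0, set0) \notin rcircuits.
Proof. by rewrite rcircuitsE /sreorient /= !set0D !set0I setU0 circuit_neq0. Qed.

Fact reorient_opp : {in rcircuits, forall X : signed E, sopp X \in rcircuits}.
Proof.
move=> X; rewrite !rcircuitsE sreorient_sopp; exact: circuit_opp.
Qed.

Fact reorient_incomp :
  {in rcircuits &, forall X Y : signed E,
    supp X \subset supp Y -> X = Y \/ X = sopp Y}.
Proof.
move=> _ _ /imsetP[X XC ->] /imsetP[Y YC ->]; rewrite !supp_sreorient.
by case/(circuit_incomp XC YC)=> ->; [left | right].
Qed.

Fact reorient_elim :
  {in rcircuits &, forall (X Y : signed E) (e : E),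
    X <> sopp Y -> e \in X.1 :&: Y.2 ->
    exists2 Z, Z \in rcircuits &
      (Z.1 \subset (X.1 :|: Y.1) :\ e) && (Z.2 \subset (X.2 :|: Y.2) :\ e)}.
Proof.
move=> _ _ /imsetP[X XC ->] /imsetP[Y YC ->] e neq eXY.
have{neq} neq : X <> sopp Y by move=> eq; apply: neq; rewrite eq.
have [Z ZC sZ] : exists2 Z, Z \in circuits M &
    (Z.1 \subset (X.1 :|: Y.1) :\ e) && (Z.2 \subset (X.2 :|: Y.2) :\ e).
  have [eA | eA] := boolP (e \in A); last first.
    apply: (circuit_elim XC YC neq); move: eXY.
    by rewrite !inE /= (negPf eA) !andbF !orbF.
  have neq' : Y <> sopp X by move=> eq; apply: neq; rewrite eq soppK.
  have [|Z ZC] := circuit_elim (e := e) YC XC neq' _.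
    by move: eXY; rewrite !inE /= eA !andbT andbC.
  by exists Z => //; rewrite ![X.1 :|: _]setUC ![X.2 :|: _]setUC.
exists (sreorient A Z); first exact: imset_f.
case/andP: sZ => /subsetP s1 /subsetP s2.
by apply/andP; split; apply/subsetP=> f; move: (s1 f) (s2 f); rewrite !inE /=;
  case: (f \in A); case: (f \in Z.1); case: (f \in Z.2) => //= t1 t2;
  rewrite ?andbT ?andbF ?orbF /= => _;
  rewrite ?(t1 isT) ?(t2 isT).
Qed.

Definition reorient : orientedMatroid E :=
  OrientedMatroid reorient_disjoint reorient_neq0 reorient_opp
                  reorient_incomp reorient_elim.

End OrientedMatroid.

Lemma underlying_reorient (E : finType) (M : orientedMatroid E) (A : {set E}) :
  mcircuits (underlying (reorient M A)) = mcircuits (underlying M).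
Proof.
rewrite /= -imset_comp; apply: eq_imset => X; exact: supp_sreorient.
Qed.

Lemma cocircuits_reorient (E : finType) (M : orientedMatroid E) (A : {set E}) :
  cocircuits (reorient M A) = sreorient A @: cocircuits M.
Proof.
apply/setP=> Y; rewrite -{2}[Y](sreorientK A).
rewrite mem_imset; last exact: can_inj (sreorientK A).
rewrite !inE supp_sreorient; congr [&& _, _ & _].
- apply/idP/idP; first exact: sreorient_disjoint.
  by move/(@sreorient_disjoint _ A); rewrite sreorientK.
- rewrite /mcocircuit /basis /indep; have -> := underlying_reorient M A; by [].
- apply/forall_inP/forall_inP=> oY X XC.
    by rewrite -(orthogonal_sreorient A) sreorientK oY //; apply: imset_f.
  case/imsetP: XC => {}X XC ->.
  by rewrite -(orthogonal_sreorient A) sreorientK oY.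
Qed.

Section Activities.

Variables (d : Order.disp_t) (E : finOrderType d).
Implicit Types (M : orientedMatroid E) (A : {set E}).

Local Open Scope order_scope.

Definition min_positive (C : {set signed E}) : {set E} :=
  [set e | [exists X in C, [&& X.2 == set0, e \in X.1 &
                               [forall f in X.1, e <= f]]]].

Definition O M : {set E} := min_positive (circuits M).

Definition Ostar M : {set E} := min_positive (cocircuits M).

Definition theta M A : nat := #|O (reorient M A) :\: A|.

Definition theta_bar M A : nat := #|O (reorient M A) :&: A|.

Definition theta_star M A : nat := #|Ostar (reorient M A) :\: A|.

Definition theta_star_bar M A : nat := #|Ostar (reorient M A) :&: A|.

End Activities.

(* Main.v *)
Require Import Defs.
From mathcomp Require Import all_boot all_order all_algebra.
From mathcomp Require Import mpoly zify ring.

(** Why the formula holds.  The elements of E are removed one at a time, the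
    largest one, w, first, and both sides are shown to obey the same
    deletion-contraction recursion.

    For the right-hand side, [Ostar_active] replaces positive cocircuits by
    circuits: by Farkas' lemma, e is the smallest element of a positive
    cocircuit if and only if no signed circuit has e in its positive part and
    only elements smaller than e in its negative part.  Hence e lies in O(N) (or
    outside O*(N)) exactly when some circuit X of N satisfies e in X^+, X^+ in a,
    X^- in b, for a suitable pair (a, b) of sets attached to e.  These pairs, one
    for each of the two kinds of activity and each element e, form a chain under
    inclusion ([region_total]).

    Let w be neither a loop nor a coloop, and let K, K' be the sets of pairs
    realised by circuits of N and of its reorientation N' at w.  Eliminating w
    between a circuit of N and one of N' shows that the deletion of w realises
    the intersection of K and K', that the contraction of w realises their union
    ([active_deletion], [active_contraction]) and, thanks to the chain
    condition, that K and K' are nested ([active_nested]).  So {K, K'} consists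
    of the data of N\w and of N/w: the terms of A and of A + w in the sum
    for M add up to the terms of A in the sums for M\w and M/w.  A loop w
    belongs to O of every reorientation, and a coloop to O*, so only the subsets
    without w contribute and they acquire a factor y, respectively x.

    The recursion of the Tutte polynomial needs the fact that adding an element
    to a set raises the rank by one exactly when the element is outside the
    closure of the set ([rank_setU1]).

    All of this rests on strong elimination ([circuits_eliminable]), in which a
    prescribed element is kept while another one is eliminated.  Unlike weak
    elimination together with incomparability of supports, it is inherited by
    the trace of a family on the complement of w, so contraction can be taken to
    be the trace of all circuits, without passing to minimal supports; the
    induction is therefore carried out for families satisfying
    [strong_system]. *)

Set Implicit Arguments.
Unset Strict Implicit.
Unset Printing Implicit Defensive.

Import Order.TTheory GRing.Theory.

(** * Strong elimination *)

Section Systems.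
Variable E : finType.
Implicit Types (X Y Z : signed E) (A S : {set E}) (F : {set signed E}).

(** Indexing the two parts of a signed set by a boolean lets both signs be
    treated by one argument. *)
Definition side (s : bool) X : {set E} := if s then X.1 else X.2.

Lemma side_sopp s X : side s (sopp X) = side (~~ s) X.
Proof. by case: s. Qed.

Lemma mem_supp X e : (e \in supp X) = (e \in side true X) || (e \in side false X).
Proof. by rewrite !inE. Qed.

Lemma side_supp s X e : e \in side s X -> e \in supp X.
Proof. by rewrite mem_supp; case: s => ->; rewrite ?orbT. Qed.

Lemma supp_side X e : e \in supp X -> exists s, e \in side s X.
Proof. by rewrite mem_supp => /orP[]; [exists true | exists false]. Qed.

Lemma side_disjoint X s e :
  [disjoint X.1 & X.2] -> e \in side s X -> e \notin side (~~ s) X.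
Proof.
move=> dX eX; apply/negP=> eX'; move/pred0P: dX => /(_ e) /=.
by case: s eX eX' => /= -> ->.
Qed.

(** Strong elimination: e has opposite signs in X and Y, and f is not cancelled
    by Y, so f can be kept with its sign in X. *)
Definition eliminable F X Y := forall s t e f,
  e \in side s X -> e \in side (~~ s) Y ->
  f \in side t X -> f \notin side (~~ t) Y ->
  exists2 Z, Z \in F & f \in side t Z /\
    forall u z, z \in side u Z ->
      z != e /\ (z \in side u X \/ z \in side u Y).

(** Supports may be empty or comparable here, so that these families are stable
    under taking traces. *)
Record strong_system F : Prop := StrongSystem {
  system_disjoint : forall X, X \in F -> [disjoint X.1 & X.2];
  system_opp : forall X, X \in F -> sopp X \in F;
  system_elim : {in F &, forall X Y, eliminable F X Y}
}.

End Systems.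

Section Strong.
Variables (E : finType) (M : orientedMatroid E).
Implicit Types (X Y Z : signed E).

Lemma circuit_elim_side X Y s e :
  X \in circuits M -> Y \in circuits M -> X <> sopp Y ->
  e \in side s X -> e \in side (~~ s) Y ->
  exists2 Z, Z \in circuits M & forall u z, z \in side u Z ->
    z != e /\ (z \in side u X \/ z \in side u Y).
Proof.
move=> XC YC nXY eX eY.
case: s eX eY => /= eX eY.
  have [|Z ZC /andP[/subsetP s1 /subsetP s2]] := circuit_elim (e := e) XC YC nXY.
    by rewrite inE eX.
  by exists Z => // -[] z /= => [/s1 | /s2]; rewrite !inE => /andP[-> /orP].
have nYX : Y <> sopp X by move=> eYX; apply: nXY; rewrite eYX soppK.
have [|Z ZC /andP[/subsetP s1 /subsetP s2]] := circuit_elim (e := e) YC XC nYX.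
  by rewrite inE eX eY.
by exists Z => // -[] z /= => [/s1 | /s2]; rewrite !inE orbC => /andP[-> /orP].
Qed.

(* The two ways in which the induction measure of [circuits_eliminable] drops:
   the union of the supports shrinks, or the flag goes from true to false. *)
Lemma measure_ltn (a b n : nat) (p q : bool) :
  2 * a + p < n.+1 -> b < a -> 2 * b + q < n.
Proof. by case: p; case: q; lia. Qed.

Lemma measure_bit (a b n : nat) :
  2 * a + true < n.+1 -> b <= a -> 2 * b + false < n.
Proof. lia. Qed.

(** By induction on twice the size of the union of the supports, plus one if f
    lies in the support of Y.  Weak elimination of e gives a circuit V; if V
    misses f, its support is not inside that of X, and it has an element g
    outside X.  Eliminating g between Y and -V while keeping e gives a circuit V',
    and eliminating e between X and V' while keeping f gives a circuit Z avoiding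
    e.  The only signs of Z not allowed by X and Y are opposite to those of V, so
    they are removed one by one by eliminating against V: this keeps f, which V
    misses, and never brings e back. *)
Lemma circuits_eliminable :
  {in circuits M &, forall X Y, eliminable (circuits M) X Y}.
Proof.
move=> X Y XC YC s t e f.
have [n] := ubnP (2 * #|supp X :|: supp Y| + (f \in supp Y)).
elim: n => // n IHn in X Y s t e f XC YC * => le_n eX eY fX fY.
have nXY : X <> sopp Y.
  by move=> eXY; rewrite eXY side_sopp (negPf fY) in fX.
have [V VC sV] := circuit_elim_side XC YC nXY eX eY.
have [fVt | fVt] := boolP (f \in side t V); first by exists V.
have fV : f \notin supp V.
  apply/negP=> /supp_side[u fV]; have [ut | nut] := eqVneq u t.
    by rewrite ut (negPf fVt) in fV.
  have {nut} ut : u = ~~ t by move: nut; case: (u); case: (t).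
  subst u; have [_ []] := sV _ _ fV; last by rewrite (negPf fY).
  by rewrite (negPf (side_disjoint (circuit_disjoint XC) fX)).
have eV : e \notin supp V.
  by apply/negP=> /supp_side[u /sV[]]; rewrite eqxx.
have sVXY : supp V \subset supp X :|: supp Y.
  apply/subsetP=> z /supp_side[u /sV[_ []]] /side_supp; rewrite in_setU => -> //.
  exact: orbT.
have eXs := side_supp eX; have fXs := side_supp fX.
have [g gV gX] : exists2 g, g \in supp V & g \notin supp X.
  apply/subsetPn/negP=> /(circuit_incomp VC XC) eVX.
  by case/negP: fV; case: eVX => ->; rewrite ?supp_sopp.
have [u gVu] := supp_side gV.
have gYu : g \in side u Y.
  by have [_ []] := sV _ _ gVu => // /side_supp; rewrite (negPf gX).
have le_sub (U : {set E}) z : U \subset supp X :|: supp Y ->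
    z \notin U -> z \in supp X :|: supp Y -> #|U| < #|supp X :|: supp Y|.
  by move=> sU zU zXY; apply/proper_card/properP; split=> //; exists z.
have [|||||||V' V'C [eV' sV']] := IHn Y (sopp V) u (~~ s) g e => //.
- exact: circuit_opp.
- rewrite supp_sopp (negPf eV).
  have sU : supp Y :|: supp V \subset supp X :|: supp Y.
    by rewrite subUset sVXY subsetUr.
  have [fYs | fYs] := boolP (f \in supp Y).
    by rewrite fYs in le_n; apply: measure_bit le_n (subset_leq_card sU).
  apply: measure_ltn le_n _; apply: (le_sub _ f) => //.
    by rewrite in_setU negb_or fYs fV.
  by rewrite in_setU fXs.
- by rewrite side_sopp negbK.
- by rewrite side_sopp; apply: contra eV => /side_supp.
have sV'XY v z : z \in side v V' ->
    z != g /\ (z \in side v Y \/ z \in side (~~ v) V).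
  by move=> /sV'; rewrite side_sopp.
have gV' : g \notin supp V'.
  by apply/negP=> /supp_side[v /sV'[]]; rewrite eqxx.
have sV'U : supp V' \subset supp X :|: supp Y.
  apply/subsetP=> z /supp_side[v /sV'XY[_ []]] /side_supp; last exact/subsetP.
  by rewrite in_setU => ->; rewrite orbT.
have [|||||Z ZC [fZ sZ]] := IHn X V' s t e f XC V'C => //.
- apply: measure_ltn le_n _.
  apply: (le_sub _ g); first by rewrite subUset sV'U subsetUl.
    by rewrite in_setU negb_or gX.
  by rewrite in_setU (side_supp gYu) orbT.
- apply/negP=> /sV'XY[_ []]; first by rewrite (negPf fY).
  by rewrite negbK => /side_supp; rewrite (negPf fV).
have {}sZ v z : z \in side v Z -> z != e /\
    [\/ z \in side v X, z \in side v Y | z \in side (~~ v) V].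
  case/sZ=> ze [zX|]; first by split=> //; constructor 1.
  by case/sV'XY=> _ []; split=> //; [constructor 2 | constructor 3].
pose bad (Z : signed E) := [set z | [exists v, (z \in side v Z)
  && (z \notin side v X :|: side v Y)]].
(* Induction on the number of bad elements; each has opposite signs in Z and V,
   and V has no bad sign, so eliminating it against V creates no new one. *)
have [m] := ubnP #|bad Z|; elim: m => // m IHm in Z ZC fZ sZ *; rewrite ltnS => le_m.
have [bad0 | [h]] := set_0Vmem (bad Z).
  exists Z => //; split=> // v z zZ; have [-> _] := sZ _ _ zZ; split=> //.
  apply/orP; apply: contraT => nz; have : z \in bad Z; last by rewrite bad0 inE.
  by rewrite inE; apply/existsP; exists v; rewrite zZ inE.
move=> hbad; have := hbad.
rewrite inE => /existsP[v /andP[hZ]]; rewrite inE negb_or => /andP[hX hY].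
have hV : h \in side (~~ v) V.
  by case: (sZ _ _ hZ) => _ [] => //; rewrite ?(negPf hX) ?(negPf hY).
have sZXY : supp Z \subset supp X :|: supp Y.
  apply/subsetP=> z /supp_side[w /sZ[_ []]] /side_supp; last exact/subsetP.
    by rewrite in_setU => ->.
  by rewrite in_setU => ->; rewrite orbT.
have eZ : e \notin supp Z.
  by apply/negP=> /supp_side[w /sZ[]]; rewrite eqxx.
have [|||||Z' Z'C [fZ' sZ']] := IHn Z V v t h f ZC VC => //.
- apply: measure_ltn le_n _.
  apply: (le_sub _ e); first by rewrite subUset sZXY.
    by rewrite in_setU negb_or eZ.
  by rewrite in_setU eXs.
- by apply: contra fV => /side_supp.
apply: (IHm Z') => //.
  move=> w z /sZ'[_ [/sZ // | zV]]; have [ze [zX|zY]] := sV _ _ zV; split=> //.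
    by constructor 1.
  by constructor 2.
apply: leq_trans le_m; apply/proper_card/properP; split; last first.
  exists h => //; rewrite inE; apply/negP=> /existsP[w /andP[/sZ'[]]].
  by rewrite eqxx.
apply/subsetP=> z; rewrite !inE => /existsP[w /andP[/sZ'[_ [zZ | zV]] zn]].
  by apply/existsP; exists w; rewrite zZ.
by have [_ /orP] := sV _ _ zV; rewrite !inE in zn *; rewrite (negPf zn).
Qed.

Lemma circuits_strong_system : strong_system (circuits M).
Proof.
split; first exact: circuit_disjoint.
  exact: circuit_opp.
exact: circuits_eliminable.
Qed.
End Strong.

(** * Closure and rank *)

Section Closure.
Variable E : finType.
Implicit Types (X Y Z : signed E) (A B W : {set E}) (F : {set signed E}).

Lemma system_elim_supp F X Y e f : strong_system F -> X \in F -> Y \in F ->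
  e \in supp X -> e \in supp Y -> f \in supp X -> f \notin supp Y ->
  exists2 Z, Z \in F & f \in supp Z /\ supp Z \subset (supp X :|: supp Y) :\ e.
Proof.
move=> sF XF YF /supp_side[s eX] /supp_side[u eY] /supp_side[t fX] fY.
have [Y' Y'F [eY' sY']] : exists2 Y', Y' \in F &
    e \in side (~~ s) Y' /\ supp Y' = supp Y.
  have [us | nus] := eqVneq u (~~ s); first by exists Y; rewrite -?us.
  exists (sopp Y); first exact: system_opp.
  by rewrite supp_sopp side_sopp negbK; case: s u nus eY {eX} => -[].
have fY' : f \notin side (~~ t) Y'.
  by rewrite -sY' in fY; apply: contra fY; apply: side_supp.
have [Z ZF [fZ sZ]] := system_elim sF XF Y'F eX eY' fX fY'.
exists Z => //; split; first exact: side_supp fZ.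
apply/subsetP=> z /supp_side[v /sZ[ze zXY]]; rewrite in_setD1 ze in_setU -sY'.
by case: zXY => /side_supp ->; rewrite ?orbT.
Qed.

(** For e outside A: e belongs to the matroid closure of A. *)
Definition closes F A e :=
  [exists X in F, (e \in supp X) && (supp X \subset e |: A)].

Lemma closesP F A e :
  reflect (exists2 X, X \in F & e \in supp X /\ supp X \subset e |: A)
          (closes F A e).
Proof.
apply: (iffP exists_inP) => -[X XF]; first by case/andP; exists X.
by case; exists X => //; apply/andP.
Qed.

Lemma closesS F A B e : A \subset B -> closes F A e -> closes F B e.
Proof.
move=> sAB /closesP[X XF [eX sX]]; apply/closesP; exists X => //; split=> //.
exact: subset_trans sX (setUS _ sAB).
Qed.

End Closure.

Section Rank.
Variables (E : finType) (M : orientedMatroid E).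
Let N := underlying M.
Implicit Types (X Y Z : signed E) (A B I J W H D : {set E}).

Lemma indep_underlyingP A :
  reflect (forall X, X \in circuits M -> ~~ (supp X \subset A)) (indep N A).
Proof.
apply: (iffP forall_inP) => iA X XC; first by apply: iA; apply: imset_f.
by case/imsetP: XC => {}X XC ->; apply: iA.
Qed.

Lemma dep_underlying A : ~~ indep N A ->
  exists2 X, X \in circuits M & supp X \subset A.
Proof.
rewrite negb_forall_in => /exists_inP[_ /imsetP[X XC ->]].
by rewrite negbK; exists X.
Qed.

Lemma indepS A B : A \subset B -> indep N B -> indep N A.
Proof.
move=> sAB /indep_underlyingP iB; apply/indep_underlyingP=> X /iB.
by apply: contra => /subset_trans; apply.
Qed.

Lemma indep_set0 : indep N set0.
Proof.
apply/indep_underlyingP=> X XC; rewrite subset0; apply/eqP=> X0.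
by have := underlying_neq0 M; rewrite -X0 imset_f.
Qed.

Lemma rank_indep I A : indep N I -> I \subset A -> #|I| <= rank N A.
Proof.
by move=> iI sIA; rewrite /rank (bigD1 I) /= ?iI // leq_max leqnn.
Qed.

Lemma rank_witness A : exists2 I, indep N I /\ I \subset A & rank N A = #|I|.
Proof.
have [|I /andP[iI sIA] rA] := eq_bigmax_cond (A := [pred B | indep N B && (B \subset A)])
    (fun B : {set E} => #|B|).
  by apply/card_gt0P; exists set0; rewrite inE indep_set0 sub0set.
by exists I.
Qed.

Lemma rankS A B : A \subset B -> rank N A <= rank N B.
Proof.
move=> sAB; have [I [iI sIA] ->] := rank_witness A.
by apply: rank_indep => //; apply: subset_trans sAB.
Qed.

(** If a circuit C of e + A contains e, an independent set J of e + A
    containing e can be exchanged for one of the same size inside A: take f in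
    C outside J; either J - e + f is independent, or it contains a circuit
    through f, and eliminating f while keeping e brings C closer to J. *)
Lemma rank_setU1 A e : e \notin A ->
  rank N (e |: A) = rank N A + ~~ closes (circuits M) A e.
Proof.
have sF := circuits_strong_system M.
move=> eA; have [I [iI sIA] rA] := rank_witness A.
have eI : e \notin I by apply: contra eA; apply/subsetP.
have [J [iJ sJA] rJ] := rank_witness (e |: A).
have leJ : #|J :\ e| <= rank N A.
  by apply: rank_indep (indepS (subsetDl _ _) iJ) _; rewrite subDset.
have [/closesP[C0 C0F [eC0 sC0]] | ncl] /= := boolP (closes _ _ _); last first.
  apply/eqP; rewrite eqn_leq; apply/andP; split.
    rewrite rJ (cardsD1 e J); have := leJ; case: (e \in J); lia.
  have <- : #|e |: I| = rank N A + 1 by rewrite cardsU1 eI rA addnC.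
  apply: rank_indep; last exact: setUS.
  apply/indep_underlyingP=> X XC; apply: contra ncl => sX; apply/closesP.
  exists X => //; split; last exact: subset_trans sX (setUS _ sIA).
  apply: contraT => eX; have /indep_underlyingP/(_ X XC)/negP[] := iI.
  apply/subsetP=> z zX; move/subsetP/(_ z zX): sX; rewrite in_setU1.
  by case/predU1P=> // ze; rewrite ze (negPf eX) in zX.
rewrite addn0; apply/eqP; rewrite eqn_leq (rankS (subsetUr _ _)) andbT.
have [eJ | eJ] := boolP (e \in J); last first.
  by rewrite rJ; move: leJ; rewrite (cardsD1 e J) (negPf eJ).
have [m] := ubnP #|supp C0 :\: J|; elim: m => // m IHm in C0 C0F eC0 sC0 *.
rewrite ltnS => le_m.
have [f fC fJ] : exists2 f, f \in supp C0 & f \notin J.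
  by apply/subsetPn; move/indep_underlyingP: iJ; apply.
have fe : f != e by apply: contraNneq fJ => ->.
have fA : f \in A by move/subsetP/(_ f fC): sC0; rewrite in_setU1 (negPf fe).
have [ifJ | /dep_underlying[D DF sD]] := boolP (indep N (f |: (J :\ e))).
  rewrite rJ -(_ : #|f |: (J :\ e)| = #|J|).
    by apply: rank_indep; rewrite // subUset sub1set fA subDset.
  by rewrite cardsU1 !inE (negPf fJ) andbF (cardsD1 e J) eJ.
have eD : e \notin supp D.
  by apply/negP=> /(subsetP sD); rewrite !inE eqxx eq_sym (negPf fe).
have fD : f \in supp D.
  apply: contraT => fD; have /indep_underlyingP/(_ D DF)/negP[] := iJ.
  apply/subsetP=> z zD; move/subsetP/(_ z zD): sD; rewrite !inE.
  by case/predU1P=> [zf|/andP[]//]; rewrite zf (negPf fD) in zD.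
have [Z ZF [eZ sZ]] := system_elim_supp sF C0F DF fC fD eC0 eD.
have sZ' z : z \in supp Z -> z != f /\ (z \in supp C0 \/ z \in J).
  move/(subsetP sZ); rewrite in_setD1 in_setU => /andP[zf /orP[zC|]]; split=> //.
    by left.
  by right; move/(subsetP sD): b; rewrite !inE (negPf zf) => /andP[].
apply: (IHm Z) => //.
  apply/subsetP=> z /sZ'[_ []]; first exact/subsetP.
  exact/subsetP.
apply: leq_trans le_m; apply/proper_card/properP; split; last first.
  by exists f; rewrite in_setD ?fJ //; apply/negP=> /andP[_ /sZ'[]]; rewrite eqxx.
apply/subsetP=> z; rewrite !in_setD => /andP[zJ /sZ'[_ []]]; rewrite zJ //.
by rewrite (negPf zJ).
Qed.

Lemma rank_full A : (forall z, z \notin A -> closes (circuits M) A z) ->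
  rank N A = rank N setT.
Proof.
have [m] := ubnP #|~: A|; elim: m => // m IHm in A * => le_m spA.
have [A0 | [z zA]] := set_0Vmem (~: A).
  by rewrite -[A]setCK A0 setC0.
rewrite in_setC in zA.
rewrite -(IHm (z |: A)).
- by rewrite rank_setU1 // spA //= addn0.
- by move: le_m; rewrite (cardsD1 z (~: A)) in_setC zA setDE -setCU setUC.
- by move=> y; rewrite in_setU1 negb_or => /andP[_ /spA]; apply: closesS; apply: subsetUr.
Qed.

Lemma basis_sub A : rank N A = rank N setT -> exists2 B, Defs.basis N B & B \subset A.
Proof.
have [I [iI sIA] ->] := rank_witness A => rI.
exists I => //; apply/maxsetP; split=> // J iJ sIJ.
by apply/esym/eqP; rewrite eqEcard sIJ rI rank_indep ?subsetT.
Qed.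

End Rank.

(** * Cocircuits and Farkas' lemma *)

Section Orthogonality.
Variable E : finType.
Implicit Types (X Y : signed E).

Definition agree X Y := [exists z, exists s, (z \in side s X) && (z \in side s Y)].

Lemma agreeP X Y :
  reflect (exists s z, z \in side s X /\ z \in side s Y) (agree X Y).
Proof.
apply: (iffP existsP) => [[z /existsP[s /andP[zX zY]]] | [s [z [zX zY]]]].
  by exists s, z.
by exists z; apply/existsP; exists s; rewrite zX.
Qed.

Lemma orthogonal_agree X Y : Defs.orthogonal X Y = (agree X Y == agree X (sopp Y)).
Proof.
have agreeE Z : agree X Z = ((X.1 :&: Z.1) :|: (X.2 :&: Z.2) != set0).
  apply/agreeP/set0Pn => [[[] [z [/= zX zZ]]] | [z]].
  - by exists z; rewrite !inE zX zZ.
  - by exists z; rewrite !inE zX zZ orbT.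
  by rewrite !inE => /orP[] /andP[]; [exists true, z | exists false, z].
by rewrite !agreeE /Defs.orthogonal /=; do 2!case: (_ == set0).
Qed.

Lemma agree_soppl X Y : agree (sopp X) Y = agree X (sopp Y).
Proof.
apply/agreeP/agreeP=> -[s [z]]; rewrite side_sopp => zXY; exists (~~ s), z.
  by rewrite side_sopp negbK.
by rewrite side_sopp negbK.
Qed.

End Orthogonality.

Section Farkas.
Variables (E : finType) (M : orientedMatroid E).
Implicit Types (X Y Z : signed E) (A H W R : {set E}).

(** A set maximal among those whose closure misses f is a hyperplane, so that
    its complement is a cocircuit. *)
Lemma mcocircuit_hyperplane f H :
  maxset [pred A : {set E} | (f \notin A) && ~~ closes (circuits M) A f] H ->
  mcocircuit (underlying M) (~: H).
Proof.
case/maxsetP=> /= /andP[fH nclH] maxH; apply/minsetP; split.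
  apply/forall_inP=> B /maxsetP[iB maxB]; apply/negP=> BH.
  have {BH} sBH : B \subset H by rewrite -[H]setCK -disjoints_subset -setI_eq0 setIC.
  have fB : f \notin B by apply: contra fH; apply/subsetP.
  have : ~~ indep (underlying M) (f |: B).
    apply/negP=> /maxB; rewrite subsetUr => /(_ isT) fBB.
    by rewrite -fBB setU11 in fB.
  case/dep_underlying=> X XC sX; case/negP: nclH; apply/closesP; exists X => //.
  split; last exact: subset_trans sX (setUS _ sBH).
  apply: contraT => fX; have /indep_underlyingP/(_ X XC)/negP[] := iB.
  apply/subsetP=> z zX; move/subsetP/(_ z zX): sX; rewrite in_setU1.
  by case/predU1P=> // zf; rewrite zf (negPf fX) in zX.
move=> D /forall_inP meetD sDH; apply/eqP; rewrite eqEsubset sDH /=.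
apply/subsetP=> d; rewrite in_setC => dH; apply: contraT => dD.
have clf z : z \notin H -> z != f -> closes (circuits M) (z |: H) f.
  move=> zH zf; apply: contraT => ncl; case/negP: zH.
  rewrite -(maxH (z |: H)) ?setU11 ?subsetUr //=.
  by rewrite in_setU1 negb_or eq_sym zf fH.
have rkf : rank (underlying M) (f |: H) = rank (underlying M) setT.
  apply: rank_full => z; rewrite in_setU1 negb_or => /andP[zf zH].
  have /closesP[X XC [fX sX]] := clf z zH zf.
  apply/closesP; exists X => //; split; last by rewrite setUCA.
  apply: contraT => zX; case/negP: nclH; apply/closesP; exists X => //; split=> //.
  apply/subsetP=> y yX; have yz : y != z by apply: contraNneq zX => <-.
  by move/subsetP/(_ y yX): sX; rewrite !in_setU1 (negPf yz).
have rkd : rank (underlying M) (d |: H) = rank (underlying M) setT.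
  have [-> // | df] := eqVneq d f.
  apply/eqP; rewrite eqn_leq rankS ?subsetT //= -rkf.
  have <- : rank (underlying M) (f |: (d |: H)) = rank (underlying M) (d |: H).
    by rewrite rank_setU1 ?clf ?addn0 // in_setU1 negb_or eq_sym df.
  by apply: rankS; rewrite setUS ?subsetUr.
have [B bB sB] := basis_sub rkd.
have := meetD B bB; rewrite setI_eq0 => /negP[]; rewrite disjoint_sym.
rewrite disjoints_subset; apply: subset_trans sB _.
rewrite subUset sub1set in_setC dD; apply/subsetP=> z zH; rewrite in_setC.
by apply/negP=> /(subsetP sDH); rewrite in_setC zH.
Qed.

(** The support of the cocircuit is the complement D of a hyperplane H
    containing W whose closure misses f.  For every other z in D, some circuit P
    with f in P^+ meets D exactly in f and z; orthogonality to P forces the sign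
    of z.  If a circuit X meeting D agreed with these signs on D, then
    eliminating its elements of D other than f against the circuits P would end
    with a circuit meeting D in f alone, which puts f in the closure of H. *)
Lemma cocircuit_avoiding f W : f \notin W -> ~~ closes (circuits M) W f ->
  exists2 Y, Y \in cocircuits M & f \in Y.1 /\ [disjoint supp Y & W].
Proof.
have sF := circuits_strong_system M => fW nclW.
have [|H maxH sWH] := @maxset_exists _
    [pred A : {set E} | (f \notin A) && ~~ closes (circuits M) A f] W.
  by rewrite /= fW.
have cocH := mcocircuit_hyperplane maxH.
case/maxsetP: maxH => /= /andP[fH nclH] maxH.
(* [pos z] says that z gets the sign of f, because z and f have opposite signs
   in some circuit whose other elements are in H. *)
pose pos z := (z == f) || [exists X in circuits M,
  [&& f \in X.1, z \in X.2 & supp X \subset f |: (z |: H)]].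
pose Y : signed E := ([set z in ~: H | pos z], [set z in ~: H | ~~ pos z]).
have YE z s : (z \in side s Y) = (z \notin H) && (pos z == s).
  by case: s; rewrite !inE ?eqb_id ?eqbF_neg.
have Yf s : (f \in side s Y) = s by rewrite YE fH /pos eqxx.
have sY : supp Y = ~: H.
  by apply/setP=> z; rewrite !inE; case: (z \in H); case: (pos z).
have chord z s : z != f -> z \in side s Y -> exists2 X, X \in circuits M &
    [/\ f \in side true X, z \in side (~~ s) X & supp X \subset f |: (z |: H)].
  move=> zf; rewrite YE => /andP[zH].
  have : closes (circuits M) (z |: H) f.
    apply: contraT => ncl; case/negP: zH.
    rewrite -(maxH (z |: H)) ?setU11 ?subsetUr //=.
    by rewrite in_setU1 negb_or eq_sym zf fH.
  case/closesP=> X XC [fX sX].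
  have {X XC fX sX} [X XC [fX sX]] : exists2 X, X \in circuits M &
      f \in X.1 /\ supp X \subset f |: (z |: H).
    case/setUP: fX => fX; first by exists X.
    by exists (sopp X); rewrite ?supp_sopp; first exact: circuit_opp.
  have zX : z \in supp X.
    apply: contraT => zX; case/negP: nclH; apply/closesP; exists X => //.
    split; first by rewrite inE fX.
    apply/subsetP=> y yX; have yz : y != z by apply: contraNneq zX => <-.
    by move/subsetP/(_ y yX): sX; rewrite !in_setU1 (negPf yz).
  have [posz | nposz] := boolP (pos z) => /eqP <-.
    case/orP: posz => [|/exists_inP[X' X'C /and3P[fX' zX' sX']]].
      by rewrite (negPf zf).
    by exists X'.
  exists X => //; split=> //=; case/setUP: zX => // zX; case/negP: nposz.
  by apply/orP; right; apply/exists_inP; exists X => //; apply/and3P.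
have noagree X : X \in circuits M -> agree X Y -> agree X (sopp Y).
  move=> XC XY; apply: contraT => nXY.
  have {nXY} sXY u z : z \notin H -> z \in side u X -> z \in side u Y.
    move=> zH zX; rewrite YE zH /=; apply: contraR nXY => pz; apply/agreeP.
    by exists u, z; split=> //; rewrite side_sopp YE zH; case: (u) pz; case: (pos z).
  case/agreeP: XY => u [z [/side_supp zX]]; rewrite YE => /andP[zH _] {u}.
  have [m] := ubnP #|supp X :\: (f |: H)|.
  elim: m => // m IHm in X z XC zH zX sXY *; rewrite ltnS => le_m.
  have [X0 | [d]] := set_0Vmem (supp X :\: (f |: H)).
    have {X0} sXH : supp X \subset f |: H by rewrite -setD_eq0 X0.
    case/negP: nclH; apply/closesP; exists X => //; split=> //.
    by move/subsetP/(_ z zX): sXH; rewrite in_setU1 (negPf zH) orbF => /eqP <-.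
  rewrite in_setD in_setU1 negb_or => /andP[/andP[df dH] dX].
  have [s dXs] := supp_side dX.
  have [P PC [fP dP sP]] := chord d s df (sXY _ _ dH dXs).
  have [||Z ZC [fZ sZ]] := system_elim sF PC XC dP _ fP.
  - by rewrite negbK.
  - by apply/negP=> /(sXY _ _ fH); rewrite Yf.
  have {}sZ v y : y \notin H -> y \in side v Z ->
      y != d /\ (y = f /\ v \/ y \in side v X).
    move=> yH /sZ[yd [yP | yX]]; split=> //; [left | by right].
    have : y \in f |: (d |: H) by apply: (subsetP sP); apply: side_supp yP.
    rewrite !in_setU1 (negPf yH) (negPf yd) !orbF => /eqP yf; split=> //.
    case: v yP => //; rewrite yf => fP'.
    by have := side_disjoint (circuit_disjoint PC) fP; rewrite fP'.
  apply: (IHm Z f) => //; first exact: side_supp fZ.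
    by move=> v y yH /(sZ _ _ yH)[_ [[-> v1] | /(sXY _ _ yH)]]; rewrite ?Yf.
  apply: leq_trans le_m; apply/proper_card/properP; split; last first.
    exists d; rewrite in_setD in_setU1 negb_or df dH //=.
    by apply/negP=> /supp_side[v /(sZ _ _ dH)[]]; rewrite eqxx.
  apply/subsetP=> y; rewrite !in_setD in_setU1 negb_or => /andP[/andP[yf yH]].
  case/supp_side=> v /(sZ _ _ yH)[_ [[/eqP] | /side_supp ->]].
    by rewrite (negPf yf).
  by rewrite yf yH.
exists Y; last first.
  split; first by have := Yf true.
  rewrite sY disjoint_sym disjoints_subset setCK; exact: sWH.
rewrite inE; apply/and3P; split; last 1 first.
- apply/forall_inP=> X XC; rewrite orthogonal_agree; apply/eqP; apply/idP/idP.
    exact: noagree.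
  by rewrite -agree_soppl => /(noagree _ (circuit_opp XC)); rewrite agree_soppl soppK.
- by apply/pred0P=> z /=; rewrite !inE; case: (pos z); rewrite !(andbF, andbT).
- by rewrite sY.
Qed.

Lemma disjoint_setU1 x A H : [disjoint x |: A & H] = (x \notin H) && [disjoint A & H].
Proof.
by rewrite -!setI_eq0 setIUl setU_eq0 !setI_eq0 disjoints_subset sub1set in_setC.
Qed.

(** Induction on the number of elements g other than f outside W and R, on
    which circuits and cocircuits must both be nonnegative.  Allow negative
    values at g for cocircuits, and forbid g to circuits: the alternative gives
    either a solution, or a cocircuit Y negative at g.  Exchanging the roles
    gives either a solution, or a circuit X negative at g.  Such X and Y cannot
    coexist, since they agree at f and nowhere have opposite signs.  When all
    elements other than f are in W or R, the alternative is whether f is in the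
    closure of W. *)
Lemma farkas f W R : f \notin W -> f \notin R -> [disjoint W & R] ->
  (exists2 X, X \in circuits M &
     [/\ f \in X.1, X.2 \subset W & [disjoint supp X & R]]) \/
  (exists2 Y, Y \in cocircuits M &
     [/\ f \in Y.1, Y.2 \subset R & [disjoint supp Y & W]]).
Proof.
have [m] := ubnP #|~: (f |: (W :|: R))|.
elim: m => // m IHm in W R * => le_m fW fR dWR.
have [full | [g]] := set_0Vmem (~: (f |: (W :|: R))).
  have inWR z : z != f -> (z \in W) || (z \in R).
    move=> zf; have : z \notin ~: (f |: (W :|: R)) by rewrite full inE.
    by rewrite !inE negbK (negPf zf).
  have [/closesP[X XC [fX sX]] | /(cocircuit_avoiding fW)[Y YC [fY dY]]] :=
      boolP (closes (circuits M) W f); last first.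
    right; exists Y => //; split=> //; apply/subsetP=> z zY.
    have zW : z \notin W.
      by apply/negP=> zW; move/pred0P/(_ z): dY; rewrite /= zW inE zY orbT.
    have zf : z != f.
      apply: contraTneq zY => ->.
      apply: (@side_disjoint _ Y true) => //.
      by move: YC; rewrite inE => /and3P[].
    by have := inWR z zf; rewrite (negPf zW).
  have {X XC fX sX} [X XC [fX sX]] : exists2 X, X \in circuits M &
      f \in X.1 /\ supp X \subset f |: W.
    case/setUP: fX => fX; first by exists X.
    by exists (sopp X); rewrite ?supp_sopp; first exact: circuit_opp.
  left; exists X => //; split=> //.
    apply/subsetP=> z zX; have := subsetP sX z.
    rewrite in_setU1 inE zX orbT => /(_ isT)/predU1P[zf | //].
    have := @side_disjoint _ X true f (circuit_disjoint XC) fX.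
    by rewrite /= -zf zX.
  apply: disjointWl sX _; rewrite -setI_eq0 setIUl setU_eq0 !setI_eq0 dWR andbT.
  by rewrite disjoints_subset sub1set in_setC.
rewrite !inE !negb_or => /and3P[gf gW gR].
have lt_m A : f |: (W :|: R) \subset A -> g \in A -> #|~: A| < m.
  move=> sA gA; apply: leq_trans (le_m : _ <= m); apply/proper_card/properP; split.
    by rewrite setCS.
  by exists g; rewrite !inE ?negbK // !negb_or gf gW.
have [||||[X XC [fX sX dX]] | [Y YC [fY sY dY]]] := IHm W (g |: R).
- by apply: lt_m; rewrite ?setUS ?subsetUr // !inE eqxx !orbT.
- by [].
- by rewrite in_setU1 negb_or eq_sym gf.
- by rewrite disjoint_sym disjoint_setU1 gW disjoint_sym.
- by left; exists X => //; split=> //; apply: disjointWr dX; apply: subsetUr.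
have [gY | gY] := boolP (g \in Y.2); last first.
  right; exists Y => //; split=> //; apply/subsetP=> z zY.
  move/subsetP/(_ z zY): sY; case/setU1P=> // zg; by rewrite -zg zY in gY.
have [||||[X XC [fX sX dX]] | [Y' YC' [fY' sY' dY']]] := IHm (g |: W) R.
- by apply: lt_m; rewrite ?setUS ?setSU ?subsetUr // !inE eqxx !orbT.
- by rewrite in_setU1 negb_or eq_sym gf.
- by [].
- by rewrite disjoint_setU1 gR.
- have [gX | gX] := boolP (g \in X.2); last first.
    left; exists X => //; split=> //; apply/subsetP=> z zX.
    move/subsetP/(_ z zX): sX; case/setU1P=> // zg; by rewrite -zg zX in gX.
  move: YC; rewrite inE => /and3P[disY _ /forall_inP/(_ X XC)].
  rewrite orthogonal_agree => /eqP; have -> : agree X Y.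
    by apply/agreeP; exists true, f.
  move/esym/agreeP=> [s [z]]; rewrite side_sopp => -[zX zY]; exfalso.
  case: s zX zY => /= zX zY.
    move/subsetP/(_ z zY): sY; case/setU1P=> [zg | zR].
      have := @side_disjoint _ X true z (circuit_disjoint XC) zX.
      by rewrite /= zg gX.
    by move/pred0P/(_ z): dX; rewrite /= zR inE zX.
  move/subsetP/(_ z zX): sX; case/setU1P=> [zg | zW].
    have := @side_disjoint _ Y true z disY zY.
    by rewrite /= zg gY.
  by move/pred0P/(_ z): dY; rewrite /= zW inE zY.
- by right; exists Y' => //; split=> //; apply: disjointWr dY'; apply: subsetUr.
Qed.

End Farkas.

(** * Minors and reorientations of systems *)

Section Minors.
Variable E : finType.
Implicit Types (X Y Z : signed E) (A B a b S : {set E}) (F : {set signed E}).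
Implicit Types (e f w z : E).

Lemma side_sreorient s A X z :
  (z \in side s (sreorient A X)) = (z \in side (s (+) (z \in A)) X).
Proof.
by case: s; rewrite !inE /=; case: (z \in A); rewrite ?(andbF, andbT, orbF).
Qed.

Lemma sreorient_notin A X : [disjoint supp X & A] -> sreorient A X = X.
Proof.
move=> /pred0P dXA; case: X dXA => P Q dXA; congr pair; apply/setP=> z;
  move: (dXA z); rewrite /= !inE;
  by case: (z \in A); case: (z \in P); case: (z \in Q).
Qed.

Lemma sreorient1_notin w X : w \notin supp X -> sreorient [set w] X = X.
Proof.
by move=> wX; rewrite sreorient_notin // disjoint_sym disjoints_subset sub1set in_setC.
Qed.

Definition reorient_system A F : {set signed E} := sreorient A @: F.

Lemma mem_reorient_system A F X :
  (X \in reorient_system A F) = (sreorient A X \in F).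
Proof. by rewrite -{1}[X](sreorientK A) mem_imset //; apply: can_inj (sreorientK A). Qed.

Lemma reorient_system_strong A F : strong_system F -> strong_system (reorient_system A F).
Proof.
move=> sF; split=> [X | X | X Y]; rewrite !mem_reorient_system.
- by move/(system_disjoint sF)/(@sreorient_disjoint _ A); rewrite sreorientK.
- by rewrite sreorient_sopp; apply: system_opp.
move=> XF YF s t e f eX eY fX fY.
have [||||Z ZF [fZ sZ]] := system_elim sF XF YF (s := s (+) (e \in A))
    (t := t (+) (f \in A)) (e := e) (f := f).
- by rewrite side_sreorient addbK.
- by rewrite -addNb side_sreorient addbK.
- by rewrite side_sreorient addbK.
- by rewrite -addNb side_sreorient addbK.
exists (sreorient A Z); first by rewrite mem_reorient_system sreorientK.
split; first by rewrite side_sreorient.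
by move=> u z; rewrite side_sreorient => /sZ[ze]; rewrite !side_sreorient addbK.
Qed.

Lemma reorient_systemK A F : reorient_system A (reorient_system A F) = F.
Proof. by apply/setP=> X; rewrite !mem_reorient_system sreorientK. Qed.

Lemma reorient_system_setU1 w A F : w \notin A ->
  reorient_system (w |: A) F = reorient_system [set w] (reorient_system A F).
Proof.
move=> wA; rewrite /reorient_system -imset_comp; apply: eq_imset => -[P Q].
congr pair; apply/setP=> z; rewrite !inE /=; have [->|] := eqVneq z w;
  by rewrite ?(negPf wA); case: (z \in A); case: (z \in P); case: (z \in Q);
     case: (w \in P); case: (w \in Q).
Qed.

Definition deletion F w := [set X in F | w \notin supp X].

Lemma mem_deletion F w X : (X \in deletion F w) = (X \in F) && (w \notin supp X).
Proof. by rewrite in_set. Qed.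

Lemma deletion_strong F w : strong_system F -> strong_system (deletion F w).
Proof.
move=> sF; split=> [X | X | X Y]; rewrite !mem_deletion.
- by case/andP=> /(system_disjoint sF).
- by case/andP=> /(system_opp sF)-> wX; rewrite supp_sopp.
move=> /andP[XF wX] /andP[YF wY] s t e f eX eY fX fY.
have [Z ZF [fZ sZ]] := system_elim sF XF YF eX eY fX fY; exists Z => //.
rewrite mem_deletion ZF; apply/negP=> /supp_side[u /sZ[_ []]] /side_supp.
  by rewrite (negPf wX).
by rewrite (negPf wY).
Qed.

Lemma reorient_deletion A F w :
  reorient_system A (deletion F w) = deletion (reorient_system A F) w.
Proof.
apply/setP=> X.
by rewrite mem_reorient_system !mem_deletion mem_reorient_system supp_sreorient.
Qed.

Definition sdel w X : signed E := (X.1 :\ w, X.2 :\ w).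

Lemma side_sdel s w X : side s (sdel w X) = side s X :\ w.
Proof. by case: s. Qed.

Lemma supp_sdel w X : supp (sdel w X) = supp X :\ w.
Proof. by rewrite /supp setDUl. Qed.

(** The trace of a family of circuits outside w contains the circuits of the
    contraction of w, and also signed sets of nonminimal support. *)
Definition contraction F w := sdel w @: F.

Lemma contraction_strong F w : strong_system F -> strong_system (contraction F w).
Proof.
move=> sF; split=> [_ /imsetP[X XF ->] | _ /imsetP[X XF ->] |].
- apply: disjointWl (subsetDl _ _) _; apply: disjointWr (subsetDl _ _) _.
  exact: system_disjoint sF _ XF.
- by apply/imsetP; exists (sopp X) => //; apply: system_opp.
move=> _ _ /imsetP[X XF ->] /imsetP[Y YF ->] s t e f.
rewrite !side_sdel !in_setD1.
case/andP=> _ eX /andP[_ eY] /andP[fw fX]; rewrite fw /= => fY.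
have [Z ZF [fZ sZ]] := system_elim sF XF YF eX eY fX fY.
exists (sdel w Z); first exact: imset_f.
rewrite side_sdel in_setD1 fw; split=> // u z.
by rewrite !side_sdel !in_setD1 => /andP[-> /sZ].
Qed.

Lemma reorient_contraction A F w :
  reorient_system A (contraction F w) = contraction (reorient_system A F) w.
Proof.
rewrite /reorient_system /contraction -!imset_comp; apply: eq_imset => -[P Q].
congr pair; apply/setP=> z; rewrite !inE /=; case: (z == w);
  by case: (z \in A); case: (z \in P); case: (z \in Q).
Qed.

Lemma closes_reorient A F B e : closes (reorient_system A F) B e = closes F B e.
Proof.
apply/closesP/closesP=> -[X XF eX]; exists (sreorient A X);
  rewrite ?supp_sreorient //; first by rewrite -mem_reorient_system.
by rewrite mem_reorient_system sreorientK.
Qed.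

Lemma closes_deletion F w A e : w \notin A -> e != w ->
  closes (deletion F w) A e = closes F A e.
Proof.
move=> wA ew; apply/closesP/closesP=> -[X].
  by rewrite mem_deletion => /andP[XF _]; exists X.
move=> XF [eX sX]; exists X => //; rewrite mem_deletion XF.
by apply: contra wA => /(subsetP sX); rewrite in_setU1 eq_sym (negPf ew).
Qed.

Lemma closes_contraction F w A e : e != w ->
  closes (contraction F w) A e = closes F (w |: A) e.
Proof.
move=> ew; apply/closesP/closesP=> [[_ /imsetP[X XF ->]] | [X XF []]].
  rewrite supp_sdel in_setD1 ew /= => -[eX]; rewrite subDset => sX.
  by exists X => //; rewrite setUCA.
move=> eX sX; exists (sdel w X); first exact: imset_f.
by rewrite supp_sdel in_setD1 ew subDset setUCA.
Qed.


Definition witnessed F a b e :=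
  [exists X in F, [&& e \in X.1, X.1 \subset a & X.2 \subset b]].

Lemma witnessedP F a b e :
  reflect (exists2 X, X \in F & [/\ e \in X.1, X.1 \subset a & X.2 \subset b])
          (witnessed F a b e).
Proof.
by apply: (iffP exists_inP) => -[X XF]; [case/and3P | move/and3P]; exists X.
Qed.

(** Comparison of F with its reorientation at w, for regions a and b such that
    only a contains w: a sign at w can then be corrected by the reorientation. *)
Section Pivot.
Variables (F : {set signed E}) (w : E).
Hypothesis sF : strong_system F.
Let F' := reorient_system [set w] F.

Lemma witnessed_elim a b e X Y s : e != w -> e \notin b ->
  X \in F -> e \in X.1 -> X.1 \subset a -> X.2 \subset w |: b ->
  Y \in F -> Y.1 \subset a -> Y.2 \subset w |: b ->
  w \in side s X -> w \in side (~~ s) Y ->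
  witnessed (deletion F w) a b e.
Proof.
move=> ew eb XF eX /subsetP X1 /subsetP X2 YF /subsetP Y1 /subsetP Y2 wX wY.
have eY : e \notin side (~~ true) Y.
  by apply/negP=> /Y2; rewrite in_setU1 (negPf ew) (negPf eb).
have [Z ZF [eZ sZ]] := system_elim sF XF YF wX wY (t := true) eX eY.
apply/witnessedP; exists Z.
  by rewrite mem_deletion ZF; apply/negP=> /supp_side[u /sZ[]]; rewrite eqxx.
split=> //; apply/subsetP=> z.
  by move/(sZ true)=> [_ [/X1 | /Y1]].
by move/(sZ false)=> [zw [/X2 | /Y2]]; rewrite in_setU1 (negPf zw).
Qed.

Variables (a b : {set E}) (e : E).
Hypotheses (wa : w \in a) (wb : w \notin b) (ew : e != w) (eb : e \notin b).

Lemma witnessed_deletion :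
  witnessed (deletion F w) a b e = witnessed F a b e && witnessed F' a b e.
Proof.
apply/idP/andP=> [/witnessedP[X] | [/witnessedP[X XF [eX X1 X2]] /witnessedP[Y]]].
  rewrite in_set => /andP[XF wX] eX.
  have X' : X \in F'.
    by rewrite mem_reorient_system sreorient1_notin //.
  by split; apply/witnessedP; exists X.
rewrite mem_reorient_system => YF [eY Y1 Y2].
have [wX | wX] := boolP (w \in supp X); last first.
  by apply/witnessedP; exists X => //; rewrite mem_deletion XF.
have [wY | wY] := boolP (w \in supp Y); last first.
  apply/witnessedP; exists Y => //; rewrite mem_deletion wY andbT.
  by rewrite sreorient1_notin // in YF.
have wX1 : w \in side true X.
  by case/setUP: wX => // /(subsetP X2); rewrite (negPf wb).
have wY1 : w \in side true Y.
  by case/setUP: wY => // /(subsetP Y2); rewrite (negPf wb).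
apply: (witnessed_elim ew eb XF eX X1 _ YF _ _ wX1).
- by apply: subset_trans X2 _; apply: subsetUr.
- apply/subsetP=> z; rewrite -[_.1]/(side true _) side_sreorient in_set1.
  by have [-> // | _] := eqVneq z w; apply: (subsetP Y1).
- apply/subsetP=> z; rewrite -[_.2]/(side false _) side_sreorient in_set1 in_setU1.
  by have [-> // | _] := eqVneq z w; apply: (subsetP Y2).
- by rewrite side_sreorient in_set1 eqxx.
Qed.

Lemma witnessed_contraction :
  witnessed (contraction F w) a b e = witnessed F a b e || witnessed F' a b e.
Proof.
apply/idP/orP=> [/witnessedP[_ /imsetP[X XF ->] []] | ]; last first.
  case=> /witnessedP[X XF [eX X1 X2]]; apply/witnessedP; exists (sdel w X).
  - exact: imset_f.
  - by rewrite /= in_setD1 ew eX; split=> //; apply: subset_trans (subsetDl _ _) _.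
  - apply/imsetP; exists (sreorient [set w] X); first by rewrite -mem_reorient_system.
    congr pair; apply/setP=> z; rewrite !inE /=;
      by case: (z == w); case: (z \in X.1); case: (z \in X.2).
  - by rewrite /= in_setD1 ew eX; split=> //; apply: subset_trans (subsetDl _ _) _.
rewrite /= in_setD1 ew /= !subDset => eX /subsetP X1 /subsetP X2.
have [wX | wX] := boolP (w \in X.2); last first.
  left; apply/witnessedP; exists X => //; split=> //; apply/subsetP=> z.
    by case/X1/setU1P=> // ->.
  by move=> zX; case/setU1P: (X2 z zX) => // zw; rewrite -zw zX in wX.
right; apply/witnessedP; exists (sreorient [set w] X).
  by rewrite mem_reorient_system sreorientK.
split; first by rewrite -[_.1]/(side true _) side_sreorient in_set1 (negPf ew).
  apply/subsetP=> z; rewrite -[_.1]/(side true _) side_sreorient in_set1.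
  have [-> // | zw] := eqVneq z w; move/X1; by rewrite in_setU1 (negPf zw).
apply/subsetP=> z; rewrite -[_.2]/(side false _) side_sreorient in_set1.
have [-> wX1 | zw] := eqVneq z w; last by move/X2; rewrite in_setU1 (negPf zw).
by have := side_disjoint (system_disjoint sF XF) wX1; rewrite /= wX.
Qed.

Lemma witnessed_loop : closes F set0 w ->
  witnessed (deletion F w) a b e = witnessed F a b e.
Proof.
case/closesP=> L LF [wL]; rewrite setU0 => sL.
apply/idP/idP=> /witnessedP[X].
  by rewrite in_set => /andP[XF _] ?; apply/witnessedP; exists X.
move=> XF [eX X1 X2]; have [wX | wX] := boolP (w \in supp X); last first.
  by apply/witnessedP; exists X => //; rewrite mem_deletion XF.
have wX1 : w \in side true X.
  by case/setUP: wX => // /(subsetP X2); rewrite (negPf wb).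
have {L LF wL sL} [L LF [wL sL]] : exists2 L, L \in F &
    w \in side false L /\ supp L \subset [set w].
  case/setUP: wL => wL; last by exists L.
  by exists (sopp L); rewrite ?supp_sopp ?side_sopp; first exact: system_opp.
have sLw s : side s L \subset [set w].
  by apply: subset_trans sL; apply/subsetP=> z /side_supp.
apply: (witnessed_elim ew eb XF eX X1 _ LF _ _ wX1 wL).
- by apply: subset_trans X2 _; apply: subsetUr.
- by apply: subset_trans (sLw true) _; rewrite sub1set.
- by apply: subset_trans (sLw false) _; apply: subsetUl.
Qed.

(** If the two witnesses both contain w, eliminating w between them keeps e,
    since the smaller negative region b' also avoids e, and stays inside the
    larger regions a and b; the result witnesses e on both sides. *)
Lemma witnessed_nested a' b' f :
  a' \subset a -> b' \subset b ->
  witnessed F a b e -> witnessed F' a' b' f ->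
  witnessed F' a b e || witnessed F a' b' f.
Proof.
move=> sa sb We /witnessedP[Y]; have /witnessedP[X XF [eX X1 X2]] := We.
rewrite mem_reorient_system => YF [fY Y1 Y2].
have [wX | wX] := boolP (w \in supp X); last first.
  apply/orP; left; apply/witnessedP; exists X => //; rewrite mem_reorient_system.
  by rewrite sreorient1_notin //.
have [wY | wY] := boolP (w \in supp Y); last first.
  apply/orP; right; apply/witnessedP; exists Y => //.
  by rewrite sreorient1_notin // in YF.
have wX1 : w \in side true X.
  by case/setUP: wX => // /(subsetP X2); rewrite (negPf wb).
have wY1 : w \in side true Y.
  by case/setUP: wY => // /(subsetP Y2)/(subsetP sb); rewrite (negPf wb).
suffices : witnessed (deletion F w) a b e.
  by rewrite witnessed_deletion => /andP[_ ->].
apply: (witnessed_elim ew eb XF eX X1 _ YF _ _ wX1).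
- by apply: subset_trans X2 _; apply: subsetUr.
- apply/subsetP=> z; rewrite -[_.1]/(side true _) side_sreorient in_set1.
  by have [-> // | _] := eqVneq z w; move/(subsetP Y1)/(subsetP sa).
- apply/subsetP=> z; rewrite -[_.2]/(side false _) side_sreorient in_set1 in_setU1.
  by have [-> // | _] := eqVneq z w; move/(subsetP Y2)/(subsetP sb).
- by rewrite side_sreorient in_set1 eqxx.
Qed.

End Pivot.
End Minors.

(** * Activities as nested conditions on circuits *)

Section Activity.
Variables (d : Order.disp_t) (E : finOrderType d).
Implicit Types (X Y : signed E) (A B S : {set E}) (F : {set signed E}).
Implicit Types (e f w z : E) (k : bool * E).

(** A pair (true, e) stands for the condition that e is the smallest element of
    a positive circuit, a pair (false, e) for the condition that e is not the
    smallest element of a positive cocircuit. *)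
Definition pos_region k : {set E} := if k.1 then [set z | (k.2 <= z)%O] else setT.
Definition neg_region k : {set E} := if k.1 then set0 else [set z | (z < k.2)%O].

Definition active F S : {set bool * E} :=
  [set k | (k.2 \in S) && witnessed F (pos_region k) (neg_region k) k.2].

Lemma region_total k l :
  (pos_region l \subset pos_region k) && (neg_region l \subset neg_region k)
  || (pos_region k \subset pos_region l) && (neg_region k \subset neg_region l).
Proof.
case: k l => [[] e] [[] f]; rewrite /pos_region /neg_region /=;
  rewrite ?subsetT ?sub0set ?subxx ?andbT ?orbT //=.
  by case/orP: (le_total e f) => ef; apply/orP; [left | right]; apply/subsetP=> z;
    rewrite !inE; apply: le_trans.
by case/orP: (le_total e f) => ef; apply/orP; [right | left]; apply/subsetP=> z;
    rewrite !inE => /lt_le_trans; apply.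
Qed.

Section Pivot.
Variables (F : {set signed E}) (S : {set E}) (w : E).
Hypotheses (sF : strong_system F) (FS : forall X, X \in F -> supp X \subset S).
Hypotheses (wS : w \in S) (wmax : forall z, z \in S -> (z <= w)%O).
Let F' := reorient_system [set w] F.

Lemma region_pivot k : k.2 \in S :\ w ->
  [/\ w \in pos_region k, w \notin neg_region k, k.2 != w & k.2 \notin neg_region k].
Proof.
rewrite in_setD1 => /andP[kw /wmax kS].
by case: k kw kS => -[] e /= ew ew'; split;
  rewrite /pos_region /neg_region ?inE //= ?ltxx // -leNgt.
Qed.

Lemma active_deletion :
  active (deletion F w) (S :\ w) = active F (S :\ w) :&: active F' (S :\ w).
Proof.
apply/setP=> k; rewrite in_setI ![k \in _]inE; case kS: (k.2 \in _) => //=.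
by have [wa wb kw kb] := region_pivot kS; apply: witnessed_deletion.
Qed.

Lemma active_contraction :
  active (contraction F w) (S :\ w) = active F (S :\ w) :|: active F' (S :\ w).
Proof.
apply/setP=> k; rewrite in_setU ![k \in _]inE; case kS: (k.2 \in _) => //=.
by have [wa wb kw kb] := region_pivot kS; apply: witnessed_contraction.
Qed.

Lemma active_loop : closes F set0 w ->
  active (deletion F w) (S :\ w) = active F (S :\ w).
Proof.
move=> lw; apply/setP=> k; rewrite ![k \in _]inE; case kS: (k.2 \in _) => //=.
by have [wa wb kw kb] := region_pivot kS; apply: witnessed_loop.
Qed.

(** The witnesses of a pair only in F and of a pair only in F' would contradict
    [witnessed_nested], applied to whichever of the two pairs has the larger
    regions. *)
Lemma active_nested :
  active F (S :\ w) \subset active F' (S :\ w)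
  \/ active F' (S :\ w) \subset active F (S :\ w).
Proof.
apply/orP; apply: contraT; rewrite negb_or.
case/andP=> /subsetPn[k kF kF'] /subsetPn[l lF' lF].
move: kF kF' lF' lF; rewrite ![_ \in active _ _]inE => /andP[kS Wk] /=.
rewrite kS /= => kF' /andP[lS Wl]; rewrite lS /= => lF.
have [kwa kwb kw kb] := region_pivot kS; have [lwa lwb lw lb] := region_pivot lS.
case/orP: (region_total k l) => /andP[ra rb].
  have := witnessed_nested sF kwa kwb kw kb ra rb Wk Wl.
  by rewrite (negPf kF') (negPf lF).
have sF' := reorient_system_strong [set w] sF.
have := witnessed_nested sF' lwa lwb lw lb ra rb Wl.
by rewrite reorient_systemK => /(_ _ Wk); rewrite (negPf kF') (negPf lF).
Qed.

(** The largest element w is the smallest element of a positive circuit only if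
    that circuit is {w}. *)
Lemma active_max_pos : ((true, w) \in active F S) = closes F set0 w.
Proof.
rewrite inE /= wS; apply/witnessedP/closesP => -[X XF].
  rewrite subset0 setU0 => -[wX X1 /eqP X2]; exists X => //.
  split; first by rewrite inE wX.
  rewrite /supp X2 setU0; apply/subsetP=> z zX; rewrite in_set1 eq_le.
  move/subsetP/(_ z zX): X1; rewrite inE => ->.
  by rewrite wmax //; apply: (subsetP (FS XF)); rewrite inE zX.
rewrite setU0 => -[wX sX].
have {X XF wX sX} [X XF [wX sX]] : exists2 X, X \in F &
    w \in X.1 /\ supp X \subset [set w].
  case/setUP: wX => wX; first by exists X.
  by exists (sopp X); rewrite ?supp_sopp; first exact: system_opp.
exists X => //; split=> //; apply/subsetP=> z zX.
  have : z \in supp X by rewrite inE zX.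
  by move/(subsetP sX)/set1P->; rewrite inE.
have : z \in supp X by rewrite inE zX orbT.
move/(subsetP sX)/set1P=> zw.
have := side_disjoint (s := true) (system_disjoint sF XF) wX.
by rewrite /= -zw zX.
Qed.

(** All other elements may be negative, so any circuit through w will do, up to
    sign. *)
Lemma active_max_neg : ((false, w) \in active F S) = closes F (S :\ w) w.
Proof.
rewrite inE /= wS; apply/witnessedP/closesP => -[X XF].
  case=> wX _ _; exists X => //; split; first by rewrite inE wX.
  by rewrite setD1K // FS.
case=> wX _.
have {X XF wX} [X XF wX] : exists2 X, X \in F & w \in X.1.
  case/setUP: wX => wX; first by exists X.
  by exists (sopp X) => //; apply: system_opp.
exists X => //; split=> //; first exact: subsetT.
apply/subsetP=> z zX; rewrite inE lt_neqAle wmax ?andbT; last first.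
  by apply: (subsetP (FS XF)); rewrite inE zX orbT.
apply: contraTneq zX => ->.
exact: (side_disjoint (s := true) (system_disjoint sF XF) wX).
Qed.

End Pivot.
End Activity.

(** * Deletion-contraction of the two sums *)

Section Weight.
Variables (E : finType) (R : comNzRingType) (x y : R).
Implicit Types (A S : {set E}) (w : E) (K : {set bool * E}).
Local Open Scope ring_scope.

(** The summand of A, when K is the set of pairs of [active] realised by the
    reorientation along A: P plays the role of O, and Q that of O*. *)
Definition weight S A K : R :=
  let P := [set e in S | (true, e) \in K] in
  let Q := [set e in S | (false, e) \notin K] in
  if [disjoint Q & A] && [disjoint P & A] then x ^+ #|Q| * y ^+ #|P| else 0.

Lemma set_filterD1 S w (p : pred E) : w \in S ->
  [set e in S | p e] =
    if p w then w |: [set e in S :\ w | p e] else [set e in S :\ w | p e].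
Proof.
move=> wS; case: ifP => pw; apply/setP=> e; rewrite !inE;
  by have [->|] := eqVneq e w; rewrite ?wS ?pw.
Qed.

Lemma weight_cross S A K w : w \in S -> w \notin A ->
  ((true, w) \in K) || ((false, w) \notin K) -> weight S (w |: A) K = 0.
Proof.
move=> wS wA wK; rewrite /weight; case: ifP => // /andP[dQ dP].
case/orP: wK => wK.
  by move/pred0P/(_ w): dP; rewrite /= !inE wS wK eqxx.
by move/pred0P/(_ w): dQ; rewrite /= !inE wS wK eqxx.
Qed.

Lemma weight_pivot S A K w : w \in S -> w \notin A ->
  weight S A K =
    x ^+ ((false, w) \notin K) * y ^+ ((true, w) \in K) * weight (S :\ w) A K.
Proof.
move=> wS wA; rewrite /weight (set_filterD1 (fun e => (true, e) \in K) wS).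
rewrite (set_filterD1 (fun e => (false, e) \notin K) wS).
set P := [set e in S :\ w | _]; set Q := [set e in S :\ w | _].
have wP : w \notin P by rewrite !inE eqxx.
have wQ : w \notin Q by rewrite !inE eqxx.
case: (_ \notin K); case: (_ \in K); rewrite ?disjoint_setU1 ?wA /= ?cardsU1 ?wP ?wQ;
  case: ifP => _; rewrite ?mulr0 ?exprD ?expr0 ?expr1 ?mul1r ?mulr1 //; ring.
Qed.

Lemma weight_neutral S A K w : w \in S -> (true, w) \notin K -> (false, w) \in K ->
  weight S A K = weight (S :\ w) A K.
Proof.
move=> wS /negPf wK1 wK2; rewrite /weight.
rewrite (set_filterD1 (fun e => (true, e) \in K) wS).
by rewrite (set_filterD1 (fun e => (false, e) \notin K) wS) wK1 wK2.
Qed.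

Lemma weight_setU1 S A K w : w \notin S -> weight S (w |: A) K = weight S A K.
Proof.
move=> wS; rewrite /weight.
have disjw (p : pred E) :
    [disjoint [set e in S | p e] & w |: A] = [disjoint [set e in S | p e] & A].
  by rewrite disjoint_sym disjoint_setU1 inE (negPf wS) disjoint_sym.
by rewrite !disjw.
Qed.

End Weight.

Section RankSum.
Variables (E : finType) (R : comNzRingType) (x y : R).
Implicit Types (A B S : {set E}) (F : {set signed E}) (e w : E).
Local Open Scope ring_scope.

Lemma sum_subsetD1 (V : nmodType) (h : {set E} -> V) S w : w \in S ->
  \sum_(A : {set E} | A \subset S) h A
    = \sum_(A : {set E} | A \subset S :\ w) (h A + h (w |: A)).
Proof.
move=> wS; rewrite (bigID (fun A : {set E} => w \in A)) /= addrC big_split /=.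
congr (_ + _).
  by apply: eq_bigl => A; rewrite subsetD1.
rewrite (reindex_onto (fun A => w |: A) (fun A => A :\ w)) /=; last first.
  by move=> A /andP[_ wA]; rewrite setD1K.
apply: eq_bigl => A; rewrite subUset sub1set wS setU11 andbT /= subsetD1.
have [wA | wA] := boolP (w \in A); last by rewrite setU1K ?eqxx.
rewrite andbF; apply/negbTE/nandP; right.
by apply: contraTneq wA => <-; rewrite !inE eqxx.
Qed.

Definition rank_of F S (rho : {set E} -> nat) := forall A e,
  A \subset S -> e \in S -> e \notin A -> rho (e |: A) = (rho A + ~~ closes F A e)%N.

Lemma rank_of_mono F S rho A B : rank_of F S rho -> A \subset B -> B \subset S ->
  (rho A <= rho B)%N /\ (rho B <= rho A + #|B :\: A|)%N.
Proof.
move=> rk; have [n] := ubnP #|B :\: A|; elim: n => // n IHn in A * => le_n sAB sBS.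
have [B0 | [e eBA]] := set_0Vmem (B :\: A).
  have -> : A = B by apply/eqP; rewrite eqEsubset sAB -setD_eq0 B0 /=.
  by rewrite leqnn leq_addr.
have := eBA; rewrite in_setD => /andP[eA eB].
have cardBA : #|B :\: A| = #|B :\: (e |: A)|.+1.
  by rewrite (cardsD1 e) eBA setDDl setUC.
have [|||le1 le2] := IHn (e |: A); rewrite ?subUset ?sub1set ?eB //.
  by rewrite cardBA in le_n.
rewrite rk ?(subset_trans sAB) ?(subsetP sBS) // in le1 le2.
by rewrite cardBA; case: (closes _ _ _) le1 le2 => /=; lia.
Qed.

(** The rank generating function of the matroid on S whose rank function is rho
    up to an additive constant, which allows the contraction of w to have rank
    function A |-> rho (w + A). *)
Definition rank_sum (rho : {set E} -> nat) S : R :=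
  \sum_(A : {set E} | A \subset S)
    (x - 1) ^+ (rho S - rho A) * (y - 1) ^+ (#|A| + rho set0 - rho A).

Lemma rank_sum_loop F S rho w : w \in S -> rank_of F S rho -> closes F set0 w ->
  rank_sum rho S = y * rank_sum rho (S :\ w).
Proof.
move=> wS rk lw; have rkw A : A \subset S :\ w -> rho (w |: A) = rho A.
  rewrite subsetD1 => /andP[sA wA]; rewrite rk //.
  by rewrite (closesS (sub0set A) lw) addn0.
rewrite /rank_sum (sum_subsetD1 _ wS) mulr_sumr; apply: eq_bigr => A sA.
have := sA; rewrite subsetD1 => /andP[sAS wA].
have [_] := rank_of_mono rk (sub0set A) sAS; rewrite setD0 => leA.
rewrite -{1 2}(setD1K wS) !rkw // cardsU1 wA.
have -> : (1 + #|A| + rho set0 - rho A = (#|A| + rho set0 - rho A).+1)%N by lia.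
rewrite exprS; ring.
Qed.

Lemma rank_sum_coloop F S rho w : w \in S -> rank_of F S rho ->
  ~~ closes F (S :\ w) w -> rank_sum rho S = x * rank_sum rho (S :\ w).
Proof.
move=> wS rk lw; have rkw A : A \subset S :\ w -> rho (w |: A) = (rho A).+1.
  move=> sA; have := sA; rewrite subsetD1 => /andP[sAS wA]; rewrite rk //.
  by rewrite (contra _ lw) ?addn1 //; apply: closesS.
rewrite /rank_sum (sum_subsetD1 _ wS) mulr_sumr; apply: eq_bigr => A sA.
have := sA; rewrite subsetD1 => /andP[sAS wA].
have [leA _] := rank_of_mono rk sA (subsetDl S [set w]).
rewrite -{1 2}(setD1K wS) !rkw // cardsU1 wA subSS.
have -> : (1 + #|A| + rho set0 - (rho A).+1 = #|A| + rho set0 - rho A)%N by lia.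
rewrite subSn // exprS; ring.
Qed.

Lemma rank_sum_pivot F S rho w : w \in S -> rank_of F S rho ->
  ~~ closes F set0 w -> closes F (S :\ w) w ->
  rank_sum rho S = rank_sum rho (S :\ w) + rank_sum (fun A => rho (w |: A)) (S :\ w).
Proof.
move=> wS rk nl nc; rewrite /rank_sum (sum_subsetD1 _ wS) big_split /=.
have rS : rho S = rho (S :\ w).
  by rewrite -{1}(setD1K wS) rk ?subsetDl ?setD11 // nc addn0.
have r0 : rho (w |: set0) = (rho set0).+1 by rewrite rk ?sub0set ?inE // nl addn1.
congr (_ + _); apply: eq_bigr => A; first by rewrite rS.
rewrite subsetD1 => /andP[_ wA]; by rewrite setD1K // cardsU1 wA r0 add1n addSnnS.
Qed.

Lemma rank_of_deletion F S rho w : rank_of F S rho -> rank_of (deletion F w) (S :\ w) rho.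
Proof.
move=> rk A e; rewrite subsetD1 in_setD1 => /andP[sA wA] /andP[ew eS] eA.
by rewrite closes_deletion // rk.
Qed.

Lemma rank_of_contraction F S rho w : w \in S -> rank_of F S rho ->
  rank_of (contraction F w) (S :\ w) (fun A => rho (w |: A)).
Proof.
move=> wS rk A e; rewrite subsetD1 in_setD1 => /andP[sA wA] /andP[ew eS] eA.
rewrite closes_contraction // setUCA rk // ?subUset ?sub1set ?wS //.
by rewrite in_setU1 negb_or ew.
Qed.

End RankSum.

Section Expansion.
Variables (d : Order.disp_t) (E : finOrderType d).
Variables (R : comNzRingType) (x y : R).
Implicit Types (X : signed E) (A B S : {set E}) (F : {set signed E}).
Implicit Types (e w z : E).
Local Open Scope ring_scope.

Lemma weight_restrict S A F B : S \subset B ->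
  weight x y S A (active F B) = weight x y S A (active F S).
Proof.
move=> /subsetP sSB; rewrite /weight.
have -> : [set e in S | (true, e) \in active F B]
    = [set e in S | (true, e) \in active F S].
  by apply/setP=> e; rewrite !inE /=; case eS: (e \in S); rewrite //= sSB.
have -> // : [set e in S | (false, e) \notin active F B]
    = [set e in S | (false, e) \notin active F S].
by apply/setP=> e; rewrite !inE /=; case eS: (e \in S); rewrite //= sSB.
Qed.

(** The deletion-contraction recursion at the largest element w of S. *)
Theorem rank_sum_activities F S rho : strong_system F ->
  (forall X, X \in F -> supp X \subset S) -> rank_of F S rho ->
  rank_sum x y rho S =
    \sum_(A : {set E} | A \subset S) weight x y S A (active (reorient_system A F) S).
Proof.
have [n] := ubnP #|S|; elim: n => // n IHn in F S rho *.
move=> le_n sF FS rk; have [-> | [w0 w0S]] := set_0Vmem S.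
  have sub0 (h : {set E} -> R) : \sum_(A : {set E} | A \subset set0) h A = h set0.
    by under eq_bigl do rewrite subset0; rewrite big_pred1_eq.
  rewrite /rank_sum !sub0 cards0 add0n !subnn !expr0 /weight.
  have s0 (p : pred E) : [set e in set0 | p e] = set0 by apply/setP=> e; rewrite !inE.
  by rewrite !s0 -setI_eq0 setI0 eqxx cards0 !expr0.
pose w := [arg max_(z > w0 in S) z]%O.
have [wS wmax] : w \in S /\ forall z, z \in S -> (z <= w)%O.
  by rewrite /w; case: arg_maxP.
move: w wS wmax => w wS wmax.
have ltS : (#|S :\ w| < n)%N by rewrite (cardsD1 w) wS in le_n.
have FDS X : X \in deletion F w -> supp X \subset S :\ w.
  by rewrite mem_deletion subsetD1 => /andP[/FS-> ->].
have IHD := IHn _ _ _ ltS (deletion_strong w sF) FDS (rank_of_deletion rk).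
have sFA A := reorient_system_strong A sF.
have FAS A X : X \in reorient_system A F -> supp X \subset S.
  by rewrite mem_reorient_system -(supp_sreorient A); apply: FS.
(* Membership of w itself depends only on whether w is a loop or a coloop. *)
have maxp A : ((true, w) \in active (reorient_system A F) S) = closes F set0 w.
  by rewrite (active_max_pos (sFA A) (FAS A) wS wmax) closes_reorient.
have maxn A : ((false, w) \in active (reorient_system A F) S) = closes F (S :\ w) w.
  by rewrite (active_max_neg (sFA A) (FAS A) wS wmax) closes_reorient.
rewrite [RHS](sum_subsetD1 _ wS).
have weight_step A : A \subset S :\ w -> weight x y S A (active (reorient_system A F) S) =
    x ^+ (~~ closes F (S :\ w) w) * y ^+ (closes F set0 w)
      * weight x y (S :\ w) A (active (reorient_system A F) (S :\ w)).
  rewrite subsetD1 => /andP[_ wA].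
  by rewrite (weight_pivot x y _ wS wA) maxp maxn weight_restrict ?subsetDl.
have [lw | lw] := boolP (closes F set0 w).
  rewrite (rank_sum_loop x y wS rk lw) IHD mulr_sumr; apply: eq_bigr => A sA.
  have := sA; rewrite subsetD1 => /andP[_ wA].
  rewrite (weight_cross x y wS wA) ?maxp ?lw // addr0 weight_step // lw.
  rewrite (closesS (sub0set _) lw) mul1r expr1; congr (_ * weight _ _ _ _ _).
  by rewrite reorient_deletion (active_loop (sFA A) wmax) // closes_reorient.
have [cw | cw] := boolP (closes F (S :\ w) w); last first.
  have delF : deletion F w = F.
    apply/setP=> X; rewrite mem_deletion andb_idr // => XF.
    apply: contra cw => wX; apply/closesP; exists X => //.
    by rewrite wX setD1K // FS.
  rewrite delF in IHD.
  rewrite (rank_sum_coloop x y wS rk cw) IHD mulr_sumr; apply: eq_bigr => A sA.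
  have := sA; rewrite subsetD1 => /andP[_ wA].
  rewrite (weight_cross x y wS wA) ?maxn ?cw ?orbT // addr0 weight_step //.
  rewrite (negPf cw) (negPf lw).
  by rewrite [y ^+ _]expr0 mulr1 [x ^+ _]expr1.
have FCS X : X \in contraction F w -> supp X \subset S :\ w.
  by case/imsetP=> {}X /FS sX ->; rewrite supp_sdel setSD.
have IHC := IHn _ _ _ ltS (contraction_strong w sF) FCS (rank_of_contraction wS rk).
rewrite (rank_sum_pivot x y wS rk lw cw) IHD IHC -big_split /=.
apply: eq_bigr => A sA; have := sA; rewrite subsetD1 => /andP[_ wA].
rewrite weight_step // cw (negPf lw) !expr0 !mul1r.
have -> : weight x y S (w |: A) (active (reorient_system (w |: A) F) S) =
    weight x y (S :\ w) A (active (reorient_system (w |: A) F) (S :\ w)).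
  rewrite (weight_neutral x y _ wS) ?maxp ?maxn // weight_setU1 ?setD11 //.
  by rewrite weight_restrict ?subsetDl.
rewrite reorient_deletion reorient_contraction reorient_system_setU1 //.
rewrite (active_deletion (sFA A) wmax) (active_contraction (sFA A) wmax).
move: (active_nested (sFA A) wmax).
move: (active _ _) (active _ _) => K' K [nest | nest].
  by rewrite (setIidPl nest) (setUidPr nest).
by rewrite (setIidPr nest) (setUidPl nest) addrC.
Qed.
End Expansion.

(** * Activities of an oriented matroid *)

Section Bridge.
Variables (d : Order.disp_t) (E : finOrderType d) (M : orientedMatroid E).

Lemma O_active : O M = [set e in setT | (true, e) \in active (circuits M) setT].
Proof.
apply/setP=> e; rewrite !inE /=; apply/exists_inP/witnessedP => -[X XC].
  case/and3P=> /eqP X2 eX /forall_inP minX; exists X => //; split=> //.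
    by apply/subsetP=> f /minX; rewrite inE.
  by rewrite X2 sub0set.
case=> eX /subsetP X1; rewrite subset0 => X2; exists X => //; apply/and3P; split=> //.
by apply/forall_inP=> f /X1; rewrite inE.
Qed.

(** Farkas' lemma with negative values of circuits allowed below e, and none of
    cocircuits; orthogonality gives the converse. *)
Lemma Ostar_active :
  Ostar M = [set e in setT | (false, e) \notin active (circuits M) setT].
Proof.
apply/setP=> e; rewrite !inE /=.
apply/exists_inP/idP => [[Y YC /and3P[/eqP Y2 eY /forall_inP minY]] | nW].
  apply/negP=> /witnessedP[X XC [eX _ /subsetP X2]].
  move: YC; rewrite inE => /and3P[_ _ /forall_inP/(_ X XC)].
  rewrite orthogonal_agree => /eqP; have -> : agree X Y.
    by apply/agreeP; exists true, e.
  move/esym/agreeP=> [[] [z]]; rewrite side_sopp /= ?Y2 ?inE => -[] // zX zY.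
  by move: (X2 z zX); rewrite inE ltNge minY.
have [|||[X XC [eX sX _]]|[Y YC [eY sY dY]]] := @farkas _ M e [set z | (z < e)%O] set0.
- by rewrite inE ltxx.
- by rewrite inE.
- by rewrite -setI_eq0 setI0.
- by case/negP: nW; apply/witnessedP; exists X => //; split=> //; apply: subsetT.
exists Y => //; rewrite -subset0 sY eY; apply/forall_inP=> z zY.
by move/pred0P/(_ z): dY; rewrite /= !inE zY /= leNgt => ->.
Qed.

End Bridge.

Local Open Scope ring_scope.

Lemma weight_theta (d : Order.disp_t) (E : finOrderType d) (M : orientedMatroid E)
    (R : comNzRingType) (x y : R) (A : {set E}) :
  weight x y setT A (active (reorient_system A (circuits M)) setT) =
    if (theta_star_bar M A == 0%N) && (theta_bar M A == 0%N)
    then x ^+ theta_star M A * y ^+ theta M A else 0.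
Proof.
have disjointE (P : {set E}) : [disjoint P & A] = (#|P :&: A| == 0)%N.
  by rewrite -setI_eq0 cards_eq0.
rewrite /weight -(O_active (reorient M A)) -(Ostar_active (reorient M A)).
rewrite !disjointE /theta_star_bar /theta_bar /theta_star /theta.
case: ifP => // /andP[dQ dP].
by rewrite -(cardsID A (Ostar _)) -(cardsID A (O _)) (eqP dQ) (eqP dP).
Qed.

Lemma tutte_rank_sum (E : finType) (N : matroid E) :
  rank N set0 = 0%N -> tutte N = rank_sum 'X_0 'X_1 (rank N) [set: E].
Proof.
move=> r0; rewrite /tutte /rank_sum; apply: eq_big => A; first by rewrite subsetT.
by rewrite r0 addn0.
Qed.

Theorem corollary3p7 (d : Order.disp_t) (E : finOrderType d)
    (M : orientedMatroid E) :
  tutte (underlying M) =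
    \sum_(A : {set E} | (theta_star_bar M A == 0%N) && (theta_bar M A == 0%N))
      'X_0 ^+ theta_star M A * 'X_1 ^+ theta M A.
Proof.
rewrite tutte_rank_sum; last first.
  by have [I [_]] := rank_witness M set0; rewrite subset0 => /eqP-> ->; rewrite cards0.
rewrite (rank_sum_activities _ _ (circuits_strong_system M)); last first.
- by move=> A e _ _; apply: rank_setU1.
- by move=> X _; apply: subsetT.
rewrite [RHS]big_mkcond; apply: eq_big => A; first by rewrite subsetT.
by rewrite weight_theta.
Qed.
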